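(* Let $p(z)=z^n+a_{n-1}z^{n-1}+\cdots+a_1z+a_0$ be a monic polynomial of degree $n$ with coefficients $a_0,\dots,a_{n-1}\in\mathbb{C}$, let $C(p)$ be its Frobenius companion matrix, and let $\lambda$ be a zero of $p(z)$. Then $$|\lambda|\le w(C(p))\le\left[\frac34\alpha+\frac14\beta^2\right]^{\frac12},$$ where $$\alpha=\left[1+\sum_{r=0}^{n-1}\left(|a_r|^2+|b_r|^2\right)\right]^{\frac12},$$ $$\beta=\left[\frac12\left(1+\sum_{r=0}^{n-1}|a_r|^2+\sqrt{\left(1+\sum_{r=0}^{n-1}|a_r|^2\right)^2-4|a_0|^2}\right)\right]^{\frac12},$$ and $b_r=a_{n-1}a_r-a_{r-1}$ for each $r=0,1,\dots,n-1$, with $a_{-1}=0$.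
   Context: The Frobenius companion matrix of $p$ is the $n\times n$ matrix $$C(p)=\begin{pmatrix}-a_{n-1}&-a_{n-2}&\cdots&-a_1&-a_0\\1&0&\cdots&0&0\\0&1&\cdots&0&0\\\vdots&\vdots&&\vdots&\vdots\\0&0&\cdots&1&0\end{pmatrix},$$ regarded as an operator on $\mathbb{C}^n$ with the usual inner product. The numerical radius of an operator $T$ on $\mathbb{C}^n$ is $w(T)=\sup\{|\langle Tx,x\rangle| : x\in\mathbb{C}^n,\ \|x\|=1\}$. *)

(* Defs.v *)
From mathcomp Require Import all_boot all_order all_algebra spectral.
From mathcomp Require Import classical_sets reals.
From mathcomp Require Import complex.

Set Implicit Arguments.
Unset Strict Implicit.
Unset Printing Implicit Defensive.

Import Order.TTheory GRing.Theory Num.Theory.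

Local Open Scope classical_set_scope.
Local Open Scope ring_scope.
Local Open Scope complex_scope.

Definition cabs (R : rcfType) (z : R[i]) : R := ComplexField.Normc.normc z.

(* [dotmx] takes row vectors, is linear in its first argument and conjugate
   linear in its second one. *)
Definition inner (R : rcfType) (n : nat) (x y : 'cV[R[i]]_n) : R[i] :=
  dotmx x^T y^T.

(* <x, x> is a nonnegative real, so that [complex.Re] only changes its type. *)
Definition l2norm (R : rcfType) (n : nat) (x : 'cV[R[i]]_n) : R :=
  Num.sqrt (complex.Re (inner x x)).

Definition numerical_radius (R : realType) (n : nat) (T : 'M[R[i]]_n) : R :=
  sup [set cabs (inner (T *m x) x) | x in [set x : 'cV[R[i]]_n | l2norm x = 1]].

(* For p monic of degree n. This is not [companionmx p] of mxpoly, which has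
   the coefficients, in increasing order, in its last row. *)
Definition frobenius_companion (R : nzRingType) (n : nat) (p : {poly R}) :
    'M[R]_n :=
  \matrix_(i < n, j < n)
    if (i == 0 :> nat) then - p`_(n.-1 - j) else (i == j.+1 :> nat)%:R.

(* Main.v *)
Require Import Defs.
From mathcomp Require Import all_boot all_order all_algebra.
From mathcomp Require Import spectral sesquilinear.
From mathcomp Require Import classical_sets reals complex.
From mathcomp Require Import ring lra.

Set Implicit Arguments.
Unset Strict Implicit.
Unset Printing Implicit Defensive.

Import Order.TTheory GRing.Theory Num.Theory.

Local Open Scope ring_scope.
Local Open Scope complex_scope.
Local Open Scope sesquilinear_scope.

(** Write [C] for the companion matrix and [|.|] for the Euclidean norm.

    The zero [lambda] of [p] is an eigenvalue of [C], with eigenvector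
    [(lambda^(n-1), ..., lambda, 1)]; at the corresponding unit vector the form
    [<C x, x>] takes the value [lambda], whence the lower bound.

    The upper bound holds for any square matrix [A] in the form
    [w(A)^2 <= 3/4 K + 1/4 B^2], where [B] and [K] bound the operator norms of
    [A] and [A^2] ([cabs_inner_mulmx_sqr_le]).  For a unit vector [x], Buzano's
    inequality applied to [A x], [x] and [A^* x] bounds [2 |<A x, x>|^2] by
    [|A x| |A^* x| + |<A^2 x, x>|].  The second term is at most [K], and the
    first is at most half of [s = |A x|^2 + |A^* x|^2], the quadratic form of
    [A^* A + A A^*] at [x].  Finally [s <= B^2 + K]
    ([l2norm_sqr_add_adj_le]): the operator norm of [A^* A + A A^*] is that of
    the block matrix with diagonal blocks [A A^*] and [A^* A] and off-diagonal
    blocks [A^2] and its adjoint.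

    It remains to check that [B = beta] and [K = alpha] are admissible for [C].
    Apart from its first row, [C] shifts the coordinates.  The first row
    contributes [|<a, x>|^2] to [|C x|^2], the other rows everything but the
    last coordinate of [x]; this reduces [|C| <= beta] to the fact that
    [beta^2] is the larger eigenvalue of a real symmetric 2 x 2 matrix with
    trace [sigma] and determinant [|a_0|^2].  The first row of [C^2] is the row
    of the [b_r], and its remaining rows are all but the last of [C], so the
    Cauchy-Schwarz inequality gives [|C^2| <= alpha]. *)

(** * The Euclidean norm and the Buzano inequality *)

Section Norms.
Variable R : rcfType.
Implicit Types (z t : R[i]).

Lemma cabsC z : (cabs z)%:C = `|z|.
Proof. by []. Qed.

Lemma cabs_ge0 z : 0 <= cabs z.
Proof. by case: z => a b; rewrite sqrtr_ge0. Qed.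

Lemma cabsM : {morph @cabs R : z t / z * t}.
Proof. exact: ComplexField.Normc.normcM. Qed.

Lemma cabsD z t : cabs (z + t) <= cabs z + cabs t.
Proof. exact: le_normcD. Qed.

Lemma cabsN z : cabs (- z) = cabs z.
Proof. by apply: complexI; rewrite !cabsC normrN. Qed.

Lemma cabsX2 z : (cabs z ^+ 2)%:C = z * z^*%R.
Proof. by rewrite rmorphXn /= cabsC normCK. Qed.

Lemma cabs_conj z : cabs z^*%R = cabs z.
Proof. by apply: complexI; rewrite !cabsC norm_conjC. Qed.

Lemma cabs_real (k : R) : 0 <= k -> cabs k%:C = k.
Proof. by move=> k0; apply: complexI; rewrite cabsC ger0_norm // ler0c. Qed.

Lemma Re_le_cabs z : complex.Re z <= cabs z.
Proof.
rewrite -lecR cabsC; apply: le_trans (normc_ge_Re z).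
by rewrite lecR ler_norm.
Qed.

Variable n : nat.
Implicit Types (x y u v : 'cV[R[i]]_n) (A : 'M[R[i]]_n).

Lemma innerE x y : inner x y = \sum_i x i 0 * (y i 0)^*%R.
Proof. by rewrite /inner dotmxE !mxE; apply: eq_bigr => i _; rewrite !mxE. Qed.

Lemma innerDl x y u : inner (x + y) u = inner x u + inner y u.
Proof. by rewrite /inner linearD /= linearDl. Qed.

Lemma innerDr x y u : inner u (x + y) = inner u x + inner u y.
Proof. by rewrite /inner linearD /= linearDr. Qed.

Lemma innerZl z x u : inner (z *: x) u = z * inner x u.
Proof. by rewrite /inner linearZ /= linearZl_LR. Qed.

Lemma innerZr z x u : inner u (z *: x) = z^*%R * inner u x.
Proof. by rewrite /inner linearZ /= linearZr_LR. Qed.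

Lemma innerC x y : inner y x = (inner x y)^*%R.
Proof.
rewrite !innerE rmorph_sum; apply: eq_bigr => i _.
by rewrite rmorphM /= conjCK mulrC.
Qed.

Lemma inner_adj A x y : inner (A *m x) y = inner x (A ^t* *m y).
Proof.
by rewrite /inner !dotmxE !trmxK map_mxM map_mxCK trmx_mul mulmxA.
Qed.

Lemma l2norm_ge0 x : 0 <= l2norm x.
Proof. exact: sqrtr_ge0. Qed.

Lemma l2norm_sqr x : l2norm x ^+ 2 = \sum_i cabs (x i 0) ^+ 2.
Proof.
have E : inner x x = (\sum_i cabs (x i 0) ^+ 2)%:C.
  by rewrite rmorph_sum innerE; apply: eq_bigr => i _; rewrite /= cabsX2.
by rewrite /l2norm E sqr_sqrtr // sumr_ge0 // => i _; rewrite sqr_ge0.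
Qed.

Lemma innerxx x : inner x x = (l2norm x ^+ 2)%:C.
Proof.
rewrite l2norm_sqr rmorph_sum innerE.
by apply: eq_bigr => i _; rewrite /= cabsX2.
Qed.

Lemma l2norm_eq0 x : l2norm x = 0 -> x = 0.
Proof.
move=> x0.
have : (inner x x == 0) = (x^T == 0) by exact: dnorm_eq0.
rewrite innerxx x0 expr0n eqxx => /esym/eqP xT0.
by apply: trmx_inj; rewrite xT0 trmx0.
Qed.

Lemma l2normZ z x : l2norm (z *: x) = cabs z * l2norm x.
Proof.
apply: (pexpIrn (ltn0Sn 1)); rewrite ?nnegrE ?mulr_ge0 ?l2norm_ge0 ?cabs_ge0 //.
apply: complexI; rewrite -innerxx innerZl innerZr exprMn rmorphM /= -innerxx.
by rewrite mulrA -cabsX2.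
Qed.

Lemma l2normD_sqr u v :
  l2norm (u + v) ^+ 2
    = l2norm u ^+ 2 + l2norm v ^+ 2 + 2 * complex.Re (inner u v).
Proof.
have E : (2 * complex.Re (inner u v))%:C = inner u v + (inner u v)^*%R.
  by rewrite rmorphM rmorph_nat -addcJ.
apply: complexI; rewrite -innerxx innerDl !innerDr (innerC u v) !innerxx.
rewrite [RHS]rmorphD /= [in RHS]E [X in _ = X + _]rmorphD /= -!addrA.
by congr (_ + _); rewrite addrA addrC.
Qed.

Lemma l2norm_le_of_sqr x y (B : R) :
  0 <= B -> l2norm y ^+ 2 <= B * l2norm x ^+ 2 ->
  l2norm y <= Num.sqrt B * l2norm x.
Proof.
move=> B_ge0 h.
rewrite -(ler_pXn2r (ltn0Sn 1)) ?nnegrE ?mulr_ge0 ?sqrtr_ge0 ?l2norm_ge0 //.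
by rewrite [leRHS]exprMn (sqr_sqrtr B_ge0).
Qed.

Lemma Cauchy_Schwarz_inner x y : cabs (inner x y) <= l2norm x * l2norm y.
Proof.
rewrite -(ler_pXn2r (ltn0Sn 1)) ?nnegrE ?mulr_ge0 ?l2norm_ge0 ?cabs_ge0 //.
have E : (l2norm x ^+ 2 * l2norm y ^+ 2)%:C = inner x x * inner y y.
  by rewrite !innerxx -rmorphM.
rewrite exprMn -lecR E rmorphXn /= cabsC.
exact: CauchySchwarz.
Qed.

Lemma Cauchy_Schwarz_sum (f g : 'I_n -> R[i]) :
  cabs (\sum_i f i * g i) ^+ 2
    <= (\sum_i cabs (f i) ^+ 2) * (\sum_i cabs (g i) ^+ 2).
Proof.
pose x := \col_i f i; pose y := \col_i (g i)^*%R.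
have -> : \sum_i f i * g i = inner x y.
  by rewrite innerE; apply: eq_bigr => i _; rewrite !mxE conjCK.
have -> : \sum_i cabs (f i) ^+ 2 = l2norm x ^+ 2.
  by rewrite l2norm_sqr; apply: eq_bigr => i _; rewrite mxE.
have -> : \sum_i cabs (g i) ^+ 2 = l2norm y ^+ 2.
  by rewrite l2norm_sqr; apply: eq_bigr => i _; rewrite mxE cabs_conj.
rewrite -exprMn ler_pXn2r ?nnegrE ?mulr_ge0 ?l2norm_ge0 ?cabs_ge0 //.
exact: Cauchy_Schwarz_inner.
Qed.

(** The mirror image [y = 2 <a, x> x - a] of [a] in the line spanned by [x] has
    the norm of [a], and [<y, b> = 2 <a, x> <x, b> - <a, b>]; so the inequality
    is the Cauchy-Schwarz inequality for [y] and [b]. *)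
Lemma Buzano x a b : l2norm x = 1 ->
  2 * (cabs (inner a x) * cabs (inner x b))
    <= l2norm a * l2norm b + cabs (inner a b).
Proof.
move=> x1; pose c := inner a x.
pose y := (2 * c) *: x - a.
have ny : l2norm y = l2norm a.
  suff : inner y y = inner a a by rewrite /l2norm => ->.
  have xx : inner x x = 1 by rewrite innerxx x1 expr1n.
  rewrite /y -scaleN1r !(innerDl, innerDr, innerZl, innerZr) (innerC a x) -/c.
  by rewrite xx !rmorphM !rmorphN !rmorph1 /= rmorph_nat; ring.
have := Cauchy_Schwarz_inner y b; rewrite ny => le_yb.
have E : 2 * c * inner x b = inner y b + inner a b.
  by rewrite /y -scaleN1r innerDl !innerZl mulN1r subrK.
have c2 : cabs (2 : R[i]) = 2.
  by rewrite -(rmorph_nat (real_complex R)) cabs_real.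
rewrite mulrA -[2 in X in X <= _]c2 -!cabsM E.
apply: le_trans (lerD le_yb (lexx _)).
exact: cabsD.
Qed.

Lemma AGM_sqr (a b : R) : 2 * (a * b) <= a ^+ 2 + b ^+ 2.
Proof. have := sqr_ge0 (a - b); lra. Qed.

(** * A numerical radius bound from norm bounds on a matrix and its square *)

(** A bound for the operator norm of [A] is one for its adjoint too, because
    [|A^* x|^2 = <A A^* x, x> <= B |A^* x| |x|]. *)
Lemma l2norm_adj_le A (B : R) : (forall x, l2norm (A *m x) <= B * l2norm x) ->
  forall x, l2norm (A ^t* *m x) <= B * l2norm x.
Proof.
move=> AB x; set y := A ^t* *m x.
have [y0|y_neq0] := eqVneq (l2norm y) 0.
  by rewrite y0; apply: le_trans (AB x); rewrite l2norm_ge0.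
have y_gt0 : 0 < l2norm y by rewrite lt_neqAle eq_sym y_neq0 l2norm_ge0.
rewrite -(ler_pM2r y_gt0) -expr2.
have -> : l2norm y ^+ 2 = cabs (inner (A *m y) x).
  by rewrite inner_adj innerxx cabs_real // sqr_ge0.
apply: le_trans (Cauchy_Schwarz_inner _ _) _.
rewrite [leRHS]mulrAC.
by apply: ler_wpM2r; [exact: l2norm_ge0 | exact: AB].
Qed.

Lemma adjmxK A : (A ^t*) ^t* = A.
Proof. by rewrite map_trmx trmxK map_mxCK. Qed.

(** With [y = A x], [z = A^* x] and [s] the left-hand side, [s] is
    [<x, A^* y + A z>], and
    [|A^* y + A z|^2 <= B^2 s + 2 |<A^2 z, y>| <= (B^2 + K) s],
    since [2 |y| |z| <= s]; the two facts combine to [s^2 <= (B^2 + K) s]. *)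
Lemma l2norm_sqr_add_adj_le A (B K : R) x : 0 <= K ->
  (forall y, l2norm (A *m y) <= B * l2norm y) ->
  (forall y, l2norm (A *m (A *m y)) <= K * l2norm y) ->
  l2norm x = 1 ->
  l2norm (A *m x) ^+ 2 + l2norm (A ^t* *m x) ^+ 2 <= B ^+ 2 + K.
Proof.
move=> K_ge0 AB A2K x1; set y := A *m x; set z := A ^t* *m x.
set s := _ + _; pose u := A ^t* *m y + A *m z.
have Es : inner x u = s%:C.
  rewrite /u innerDr -inner_adj -{2}(adjmxK A) -inner_adj !innerxx.
  by rewrite -rmorphD.
have s_ge0 : 0 <= s by rewrite addr_ge0 ?sqr_ge0.
have BK_ge0 : 0 <= B ^+ 2 + K by rewrite addr_ge0 ?sqr_ge0.
have s_le : s <= l2norm u.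
  by have := Cauchy_Schwarz_inner x u; rewrite Es cabs_real // x1 mul1r.
have [s0|s_neq0] := eqVneq s 0; first by rewrite s0.
have s_gt0 : 0 < s by rewrite lt_neqAle eq_sym s_neq0.
rewrite -(ler_pM2r s_gt0) -expr2.
have sq a b : 0 <= a -> a <= B * b -> a ^+ 2 <= B ^+ 2 * b ^+ 2.
  move=> a0 ab; rewrite -exprMn ler_pXn2r ?nnegrE //; exact: le_trans ab.
have hy := sq _ _ (l2norm_ge0 _) (l2norm_adj_le AB y).
have hz := sq _ _ (l2norm_ge0 _) (AB z).
have hyz : complex.Re (inner (A ^t* *m y) (A *m z)) <= K * (l2norm y * l2norm z).
  apply: le_trans (Re_le_cabs _) _.
  rewrite innerC cabs_conj -inner_adj.
  apply: le_trans (Cauchy_Schwarz_inner _ _) _.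
  rewrite [l2norm y * _ in leRHS]mulrC mulrA.
  by apply: ler_wpM2r; [exact: l2norm_ge0 | exact: A2K].
have Kyz := ler_wpM2l K_ge0 (AGM_sqr (l2norm y) (l2norm z)).
have us : s ^+ 2 <= l2norm u ^+ 2.
  apply: (lerXn2r 2 _ _ s_le); rewrite nnegrE; first exact: s_ge0.
  exact: l2norm_ge0.
apply: le_trans us _; rewrite /u l2normD_sqr [leRHS]mulrDl.
apply: le_trans (lerD (lerD hy hz) (ler_wpM2l (ler0n R 2) hyz)) _.
by rewrite -mulrDr lerD2l mulrCA.
Qed.

(** The weight [3/4] of [K] is made of [1/2] from the term [<A^2 x, x>] in the
    Buzano inequality and [1/4] from the bound on [|A x|^2 + |A^* x|^2]. *)
Lemma cabs_inner_mulmx_sqr_le A (B K : R) x : 0 <= K ->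
  (forall y, l2norm (A *m y) <= B * l2norm y) ->
  (forall y, l2norm (A *m (A *m y)) <= K * l2norm y) ->
  l2norm x = 1 ->
  cabs (inner (A *m x) x) ^+ 2 <= 3 / 4 * K + 1 / 4 * B ^+ 2.
Proof.
move=> K_ge0 AB A2K x1.
have combine (c d r q : R) : 2 * (c * c) <= r * q + d -> d <= K ->
    r ^+ 2 + q ^+ 2 <= B ^+ 2 + K -> c ^+ 2 <= 3 / 4 * K + 1 / 4 * B ^+ 2.
  by have := AGM_sqr r q; clear; lra.
have hs := l2norm_sqr_add_adj_le K_ge0 AB A2K x1.
have := Buzano (A *m x) (A ^t* *m x) x1.
rewrite -!inner_adj => hB; apply: combine hB _ hs.
apply: le_trans (Cauchy_Schwarz_inner _ _) _.
by have := A2K x; rewrite x1 !mulr1.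
Qed.

End Norms.

(** * Numerical radius and eigenvalues *)

Section NumericalRadius.
Variables (R : realType) (n : nat).
Implicit Types (x v : 'cV[R[i]]_n) (A : 'M[R[i]]_n).

(** Without boundedness the supremum defining the numerical radius would be a
    default value; the Frobenius norm of [A] is a sufficient bound. *)
Lemma l2norm_mulmx_bounded A :
  exists B : R, forall x, l2norm (A *m x) <= B * l2norm x.
Proof.
pose F := \sum_i \sum_j cabs (A i j) ^+ 2.
have F_ge0 : 0 <= F.
  by apply: sumr_ge0 => i _; apply: sumr_ge0 => j _; apply: sqr_ge0.
exists (Num.sqrt F) => x.
apply: (l2norm_le_of_sqr F_ge0).
rewrite [leLHS]l2norm_sqr [X in _ <= _ * X]l2norm_sqr [leRHS]mulr_suml.
apply: ler_sum => i _.
by rewrite mxE; apply: Cauchy_Schwarz_sum.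
Qed.

Lemma cabs_inner_le_numerical_radius A x : l2norm x = 1 ->
  cabs (inner (A *m x) x) <= numerical_radius A.
Proof.
have [B AB] := l2norm_mulmx_bounded A.
move=> x1; apply: ub_le_sup; last by exists x.
exists B => _ [y /= y1 <-]; apply: le_trans (Cauchy_Schwarz_inner _ _) _.
by rewrite y1 mulr1; apply: le_trans (AB y) _; rewrite y1 mulr1.
Qed.

Lemma exists_unit_vector v : v != 0 ->
  exists k : R[i], l2norm (k *: v) = 1.
Proof.
move=> v_neq0.
have v_gt0 : l2norm v != 0 by apply: contra v_neq0 => /eqP/l2norm_eq0/eqP.
exists (l2norm v)^-1%:C.
by rewrite l2normZ cabs_real ?invr_ge0 ?l2norm_ge0 // mulVf.
Qed.

Lemma eigenvalue_le_numerical_radius A v (lambda : R[i]) :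
  v != 0 -> A *m v = lambda *: v -> cabs lambda <= numerical_radius A.
Proof.
move=> v_neq0 Av; have [k u1] := exists_unit_vector v_neq0.
apply: le_trans (cabs_inner_le_numerical_radius A u1).
rewrite -scalemxAr Av scalerA mulrC -scalerA innerZl cabsM innerxx u1.
by rewrite expr1n cabs_real ?ler01 // mulr1.
Qed.

(** The vector [v] witnesses that the dimension is positive: the supremum is
    then taken over a nonempty set and is a least upper bound. *)
Lemma numerical_radius_le A (w : R) v : v != 0 ->
  (forall x, l2norm x = 1 -> cabs (inner (A *m x) x) <= w) ->
  numerical_radius A <= w.
Proof.
move=> v_neq0 Aw; have [k u1] := exists_unit_vector v_neq0.
apply: ge_sup; last by move=> _ [x /= x1 <-]; apply: Aw.
by exists (cabs (inner (A *m (k *: v)) (k *: v))); exists (k *: v).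
Qed.

End NumericalRadius.

(** * The quadratic form behind beta *)

(** The left-hand side is the quadratic form of the symmetric 2 x 2 matrix
    with rows [(A^2 + 1, A c)] and [(A c, c^2)], whose trace is [sigma] and
    whose determinant is [c^2], so [beta2] is its larger eigenvalue. Hence
    [p = beta2 - (A^2 + 1)] and [q = beta2 - c^2] are nonnegative with
    [p q = (A c)^2], and the difference of the two sides is a square. *)
Lemma larger_eigenvalue_ge (R : rcfType) (A c : R) :
  let sigma := 1 + (A ^+ 2 + c ^+ 2) in
  let beta2 := 1 / 2 * (sigma + Num.sqrt (sigma ^+ 2 - 4 * c ^+ 2)) in
  0 <= A -> 0 <= c ->
  forall u v, (A * u + c * v) ^+ 2 + u ^+ 2 <= beta2 * (u ^+ 2 + v ^+ 2).
Proof.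
move=> sigma beta2 A_ge0 c_ge0 u v.
pose d := sigma ^+ 2 - 4 * c ^+ 2.
have d_ge : (sigma - 2 * c ^+ 2) ^+ 2 + 4 * A ^+ 2 * c ^+ 2 = d.
  by rewrite /d /sigma; ring.
have sq_d : Num.sqrt d ^+ 2 = d.
  by rewrite sqr_sqrtr // -d_ge addr_ge0 ?sqr_ge0 // !mulr_ge0 ?sqr_ge0.
pose e := Num.sqrt d.
have e_ge : `|sigma - 2 * c ^+ 2| <= e.
  rewrite -(ler_pXn2r (ltn0Sn 1)) ?nnegrE ?sqrtr_ge0 // sq_d -d_ge.
  by rewrite real_normK ?num_real // lerDl !mulr_ge0 ?sqr_ge0.
move: e_ge; rewrite ler_norml => /andP[e1 e2].
pose p := beta2 - (A ^+ 2 + 1); pose q := beta2 - c ^+ 2.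
have p_ge0 : 0 <= p by move: e2; rewrite /p /beta2 -/d -/e /sigma; lra.
have q_ge0 : 0 <= q by move: e1; rewrite /q /beta2 -/d -/e /sigma; lra.
have pq : p * q = (A * c) ^+ 2.
  have -> : p * q = 1 / 4 * (e ^+ 2 - d) + (A * c) ^+ 2.
    by rewrite /p /q /beta2 -/d -/e /d /sigma; field.
  by rewrite sq_d subrr mulr0 add0r.
have Ac : A * c = Num.sqrt p * Num.sqrt q.
  by rewrite -sqrtrM // pq sqrtr_sqr ger0_norm ?mulr_ge0.
have := sqr_ge0 (Num.sqrt p * u - Num.sqrt q * v).
have -> : (Num.sqrt p * u - Num.sqrt q * v) ^+ 2 = p * u ^+ 2 + q * v ^+ 2
    - 2 * (A * c) * (u * v).
  by rewrite Ac -{2}(sqr_sqrtr p_ge0) -{2}(sqr_sqrtr q_ge0); ring.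
by rewrite /p /q; clear; lra.
Qed.

(** * The companion matrix *)

Section Companion.
Variables (R : rcfType) (m : nat) (p : {poly R[i]}).
Local Notation C := (frobenius_companion m.+1 p).
Local Notation init j := (widen_ord (leqnSn m) j).
Implicit Types x : 'cV[R[i]]_m.+1.

Lemma mul_companion0 x :
  (C *m x) ord0 0 = - \sum_(j < m.+1) p`_(m - j)%N * x j 0.
Proof.
by rewrite mxE -sumrN; apply: eq_bigr => j _; rewrite mxE /= mulNr.
Qed.

Lemma mul_companionS x (j : 'I_m) : (C *m x) (lift ord0 j) 0 = x (init j) 0.
Proof.
rewrite mxE (bigD1 (init j)) //= big1 ?addr0 => [|k k_neq].
  by rewrite mxE /= eqxx mul1r.
rewrite mxE /= /bump /= add1n eqSS.
by move: k_neq; rewrite -val_eqE /= eq_sym => /negPf ->; rewrite mul0r.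
Qed.

Lemma l2norm_mul_companion x :
  l2norm (C *m x) ^+ 2
    = cabs (\sum_(j < m.+1) p`_(m - j)%N * x j 0) ^+ 2
      + \sum_(j < m) cabs (x (init j) 0) ^+ 2.
Proof.
rewrite l2norm_sqr big_ord_recl mul_companion0 cabsN; congr (_ + _).
by apply: eq_bigr => j _; rewrite mul_companionS.
Qed.

(** The first row of [C] lists the coefficients in decreasing order. *)
Lemma sum_rev_coef (f : nat -> R) :
  \sum_(j < m.+1) f (m - j)%N = \sum_(r < m.+1) f r.
Proof.
rewrite [RHS](reindex_inj rev_ord_inj).
by apply: eq_bigr => j _; rewrite /= subSS.
Qed.

(** The first row of [C^2] is that of [C] times [C]: its leading entry
    [-a_(n-1)] multiplies the first row of [C], and its other entries move one
    place to the left. The resulting entries are the [b_r]. *)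
Lemma mul_companion2_0 x :
  (C *m (C *m x)) ord0 0 =
    \sum_(j < m.+1)
      (p`_m * p`_(m - j)%N - (if (m - j)%N is r.+1 then p`_r else 0)) * x j 0.
Proof.
have -> : (C *m (C *m x)) ord0 0 =
    p`_m * (\sum_(j < m.+1) p`_(m - j)%N * x j 0)
    - \sum_(j < m) p`_(m - j.+1)%N * x (init j) 0.
  rewrite mul_companion0 big_ord_recl mul_companion0 subn0 mulrN opprD opprK.
  by congr (_ - _); apply: eq_bigr => j _; rewrite mul_companionS lift0.
under [RHS]eq_bigr => j _ do rewrite mulrBl -mulrA.
rewrite sumrB -mulr_sumr [X in _ = _ - X]big_ord_recr /= subnn mul0r addr0.
by congr (_ - _); apply: eq_bigr => j _; rewrite -(subnSK (ltn_ord j)).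
Qed.

Lemma sum_init_le x : \sum_(j < m) cabs (x (init j) 0) ^+ 2 <= l2norm x ^+ 2.
Proof. by rewrite l2norm_sqr big_ord_recr /= lerDl sqr_ge0. Qed.

(** The [b_r] control the first entry of [C^2 x]; its other entries are entries
    of [C x], and [|C x|^2] is controlled by [1] and the [a_r]. *)
Lemma l2norm_companion2_sqr_le x :
  l2norm (C *m (C *m x)) ^+ 2 <=
    (1 + \sum_(r < m.+1) (cabs p`_r ^+ 2 +
      cabs (p`_m * p`_r - (if (r : nat) is r'.+1 then p`_r' else 0)) ^+ 2))
    * l2norm x ^+ 2.
Proof.
pose b (r : nat) : R[i] := p`_m * p`_r - (if r is r'.+1 then p`_r' else 0).
have E : l2norm (C *m (C *m x)) ^+ 2
    = cabs (\sum_(j < m.+1) b (m - j)%N * x j 0) ^+ 2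
      + \sum_(j < m) cabs ((C *m x) (init j) 0) ^+ 2.
  rewrite [LHS]l2norm_sqr big_ord_recl mul_companion2_0; congr (_ + _).
  by apply: eq_bigr => j _; rewrite mul_companionS.
rewrite [leLHS]E.
have Ex : \sum_(j < m.+1) cabs (x j 0) ^+ 2 = l2norm x ^+ 2.
  by rewrite [RHS]l2norm_sqr.
have := Cauchy_Schwarz_sum (fun j : 'I_m.+1 => b (m - j)%N) (fun j => x j 0).
rewrite Ex (sum_rev_coef (fun r => cabs (b r) ^+ 2)) => le_b.
have := Cauchy_Schwarz_sum (fun j : 'I_m.+1 => p`_(m - j)%N) (fun j => x j 0).
rewrite Ex (sum_rev_coef (fun r => cabs p`_r ^+ 2)) => le_a.
rewrite big_split /= addrA [leRHS]mulrDl [leRHS]addrC.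
apply: lerD le_b _; apply: le_trans (sum_init_le _) _.
rewrite [leLHS]l2norm_mul_companion [leRHS]mulrDl [X in _ <= X + _]mul1r.
rewrite [leRHS]addrC.
exact: lerD le_a (sum_init_le x).
Qed.

(** The last coordinate is singled out: by the triangle and Cauchy-Schwarz
    inequalities the first entry of [C x] is at most [A u + c v], with [c] the
    absolute value of [a_0], [A] the norm of the other coefficients, [v] the
    absolute value of the last coordinate of [x], and [u] the norm of the
    others. *)
Lemma l2norm_companion_sqr_le x (sigma : R) :
  sigma = 1 + \sum_(r < m.+1) cabs p`_r ^+ 2 ->
  l2norm (C *m x) ^+ 2 <=
    1 / 2 * (sigma + Num.sqrt (sigma ^+ 2 - 4 * cabs p`_0%N ^+ 2)) * l2norm x ^+ 2.
Proof.
move=> sigma_def.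
pose A2 := \sum_(j < m) cabs p`_(m - j)%N ^+ 2.
pose u2 := \sum_(j < m) cabs (x (init j) 0) ^+ 2.
have A2_ge0 : 0 <= A2 by apply: sumr_ge0 => j _; apply: sqr_ge0.
have u2_ge0 : 0 <= u2 by apply: sumr_ge0 => j _; apply: sqr_ge0.
have sigmaE : sigma = 1 + (Num.sqrt A2 ^+ 2 + cabs p`_0%N ^+ 2).
  rewrite sqr_sqrtr // sigma_def -(sum_rev_coef (fun r => cabs p`_r ^+ 2)).
  by rewrite big_ord_recr /= subnn.
rewrite sigmaE.
have := larger_eigenvalue_ge (sqrtr_ge0 A2) (cabs_ge0 p`_0)
  (Num.sqrt u2) (cabs (x ord_max 0)).
rewrite [in X in _ <= _ * X](sqr_sqrtr u2_ge0).
have -> : u2 + cabs (x ord_max 0) ^+ 2 = l2norm x ^+ 2.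
  by rewrite l2norm_sqr big_ord_recr.
apply: le_trans; rewrite l2norm_mul_companion (sqr_sqrtr u2_ge0) lerD2r.
rewrite lerXn2r ?nnegrE ?addr_ge0 ?mulr_ge0 ?sqrtr_ge0 ?cabs_ge0 //.
rewrite big_ord_recr /= subnn; apply: le_trans (cabsD _ _) _.
rewrite cabsM lerD2r -sqrtrM // -(ler_pXn2r (ltn0Sn 1)) ?nnegrE
  ?sqrtr_ge0 ?cabs_ge0 //.
by rewrite sqr_sqrtr ?mulr_ge0 //; apply: Cauchy_Schwarz_sum.
Qed.

Definition power_vector (z : R[i]) : 'cV[R[i]]_m.+1 := \col_j z ^+ (m - j)%N.

Lemma power_vector_neq0 z : power_vector z != 0.
Proof.
apply/eqP => /matrixP/(_ ord_max 0); rewrite !mxE subnn expr0.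
by move/eqP; rewrite oner_eq0.
Qed.

Lemma mul_companion_power_vector z :
  p \is monic -> size p = m.+2 -> root p z ->
  C *m power_vector z = z *: power_vector z.
Proof.
move=> p_monic p_deg /rootP pz0; apply/matrixP => i k; rewrite ord1 {k}.
case: (unliftP ord0 i) => [j|] ->.
  by rewrite mul_companionS !mxE /= /bump /= add1n -exprS (subnSK (ltn_ord j)).
rewrite mul_companion0 !mxE subn0 -exprS; apply/esym/eqP.
rewrite -addr_eq0; apply/eqP.
rewrite -[RHS]pz0 horner_coef p_deg [RHS]big_ord_recr /=.
move: p_monic; rewrite monicE lead_coefE p_deg /= => /eqP ->.
rewrite mul1r addrC; congr (_ + _); rewrite [RHS](reindex_inj rev_ord_inj).
by apply: eq_bigr => j _; rewrite mxE /= subSS.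
Qed.

End Companion.

(** * The bounds for the zeros *)

Theorem theorem3p19 (R : realType) (n : nat) (p : {poly R[i]}) (lambda : R[i])
    (n_gt0 : (0 < n)%N) (p_monic : p \is monic) (p_deg : size p = n.+1)
    (p_lambda : root p lambda) :
  let a (r : nat) : R[i] := p`_r in
  let b (r : nat) : R[i] :=
    a n.-1 * a r - (if r is r'.+1 then a r' else 0) in
  let alpha : R :=
    Num.sqrt (1 + \sum_(r < n) (cabs (a r) ^+ 2 + cabs (b r) ^+ 2)) in
  let sigma : R := 1 + \sum_(r < n) cabs (a r) ^+ 2 in
  let beta : R :=
    Num.sqrt (1 / 2 * (sigma + Num.sqrt (sigma ^+ 2 - 4 * cabs (a 0%N) ^+ 2))) in
  cabs lambda <= numerical_radius (frobenius_companion n p) /\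
  numerical_radius (frobenius_companion n p)
    <= Num.sqrt (3 / 4 * alpha + 1 / 4 * beta ^+ 2).
Proof.
case: n n_gt0 p_deg => [//|m] _ p_deg a b alpha sigma beta.
have v_neq0 := power_vector_neq0 m lambda.
have Cv := mul_companion_power_vector p_monic p_deg p_lambda.
split; first exact: eigenvalue_le_numerical_radius v_neq0 Cv.
have sigma_ge0 : 0 <= sigma.
  by apply: addr_ge0; [exact: ler01 | apply: sumr_ge0 => r _; exact: sqr_ge0].
have alpha2_ge0 : 0 <= 1 + \sum_(r < m.+1) (cabs (a r) ^+ 2 + cabs (b r) ^+ 2).
  apply: addr_ge0; first exact: ler01.
  by apply: sumr_ge0 => r _; apply: addr_ge0; exact: sqr_ge0.
have beta2_ge0 :
    0 <= 1 / 2 * (sigma + Num.sqrt (sigma ^+ 2 - 4 * cabs (a 0%N) ^+ 2)).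
  apply: mulr_ge0; first by rewrite divr_ge0 ?ler0n.
  by apply: addr_ge0; [exact: sigma_ge0 | exact: sqrtr_ge0].
have C_le x :=
  l2norm_le_of_sqr beta2_ge0 (l2norm_companion_sqr_le x (erefl sigma)).
have C2_le x :=
  l2norm_le_of_sqr alpha2_ge0 (l2norm_companion2_sqr_le p x).
apply: (numerical_radius_le v_neq0) => x x1.
rewrite -[leLHS]ger0_norm ?cabs_ge0 // -sqrtr_sqr; apply: ler_wsqrtr.
exact: (cabs_inner_mulmx_sqr_le (sqrtr_ge0 _) C_le C2_le x1).
Qed.
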